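(* Let $(X,\mathcal{A},\mu)$ be a monotone measure space. If $\mu$ is subadditive, then for any $f,g\in\mathcal{F}^{+}$, $$\int^{pan}(f+g)\,d\mu=\int^{pan}f\,d\mu+\int^{pan}g\,d\mu$$ (an equality in $[0,\infty]$).
   Context: $X$ is a nonempty set and $\mathcal{A}$ a $\sigma$-algebra of subsets of $X$. $\mathcal{F}$ is the class of all real-valued $\mathcal{A}$-measurable functions on $X$, and $\mathcal{F}^{+}$ is the set of nonnegative functions in $\mathcal{F}$. A monotone measure on $(X,\mathcal{A})$ is a set function $\mu:\mathcal{A}\to[0,+\infty]$ with $\mu(\emptyset)=0$, $\mu(X)>0$, and $\mu(A)\le\mu(B)$ whenever $A\subset B$, $A,B\in\mathcal{A}$; then $(X,\mathcal{A},\mu)$ is called a monotone measure space. $\mu$ is subadditive if $\mu(A\cup B)\le\mu(A)+\mu(B)$ for all $A,B\in\mathcal{A}$. For $f\in\mathcal{F}^{+}$, the pan-integral (based on the usual $+$ and $\cdot$) is $$\int^{pan}f\,d\mu=\sup\Big\{\sum_{i=1}^{n}\lambda_i\mu(A_i):\ \sum_{i=1}^{n}\lambda_i\chi_{A_i}\le f,\ \{A_i\}_{i=1}^{n}\subset\mathcal{A}\text{ is a partition of }X,\ \lambda_i\ge 0,\ n\in\mathbb{N}\Big\}\in[0,\infty],$$ where $\chi_A$ is the characteristic function of $A$, a (finite) partition of $X$ is a finite family of pairwise disjoint sets in $\mathcal{A}$ with union $X$, and $0\cdot\infty=0$. *)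

(* Defs.v *)
From HB Require Import structures.
From mathcomp Require Import all_boot all_order all_algebra.
From mathcomp Require Import all_classical all_reals all_analysis.

Set Implicit Arguments.
Unset Strict Implicit.
Unset Printing Implicit Defensive.

Import Order.TTheory GRing.Theory Num.Theory.
Local Open Scope classical_set_scope.
Local Open Scope ring_scope.
Local Open Scope ereal_scope.

Section pan_integral.
Context d (T : measurableType d) (R : realType).
Implicit Types (mu : set T -> \bar R) (f : T -> R).

(* A set function on the sigma-algebra is represented by a function on all
   subsets of T, constrained only on the measurable ones. *)
Record monotone_measure mu : Prop := MonotoneMeasure {
  monotone_measure_ge0 : forall A, measurable A -> 0 <= mu A ;
  monotone_measure0 : mu set0 = 0 ;
  monotone_measureT_gt0 : 0 < mu setT ;
  le_monotone_measure : forall A B, measurable A -> measurable B ->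
    A `<=` B -> mu A <= mu B }.

Definition subadditive_set_fun mu : Prop :=
  forall A B, measurable A -> measurable B -> mu (A `|` B) <= mu A + mu B.

(* Blocks may be empty, unlike in the library's [partition]. *)
Definition measurable_partition n (A : 'I_n -> set T) : Prop :=
  [/\ forall i, measurable (A i),
      trivIset setT A &
      \bigcup_i A i = setT].

(* The product in \bar R satisfies 0 * +oo = 0. *)
Definition pan_integral mu f : \bar R :=
  ereal_sup [set s | exists (n : nat) (A : 'I_n -> set T) (l : 'I_n -> R),
    [/\ measurable_partition A,
        forall i, (0 <= l i)%R,
        forall x, (\sum_(i < n) l i * \1_(A i) x <= f x)%R &
        s = \sum_(i < n) (l i)%:E * mu (A i)]].

End pan_integral.

(* Main.v *)
Require Import Defs.
From HB Require Import structures.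
From mathcomp Require Import all_boot all_order all_algebra.
From mathcomp Require Import all_classical all_reals all_analysis.
From mathcomp Require Import measurable_realfun lra zify.

Set Implicit Arguments.
Unset Strict Implicit.
Unset Printing Implicit Defensive.

Import Order.TTheory GRing.Theory Num.Theory.
Local Open Scope classical_set_scope.
Local Open Scope ring_scope.
Local Open Scope ereal_scope.

(** A finite measurable partition is encoded by a classifying map from the space
to a finite type, whose fibers are the blocks (possibly empty). The two
partition axioms then hold by construction, the inequality
sum_i l_i chi_(A_i) <= f becomes the pointwise inequality l (c x) <= f x, and
common refinement is pairing of maps.

Subadditivity enters only through [level_sum_coarsen]: splitting the blocks of
a partition while keeping the coefficients does not decrease the sum
sum_i l_i mu(A_i). Both inequalities of the theorem follow from this.

- pan(f) + pan(g) <= pan(f + g): given a sum below f and a sum below g, pass to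
  the common refinement of the two partitions; there the coefficients can be
  added, which gives a sum below f + g ([level_sumD_le_pan]).

- pan(f + g) <= pan(f) + pan(g): let sum_i l_i chi_(A_i) <= f + g. Cut each
  block A_i according to which of the grid points 0, h_i, ..., (n + 1) h_i,
  with h_i = l_i / (n + 1), is the last one not above f. Where it is k h_i, we
  have k h_i <= f, and also g >= (n - k) h_i when k <= n, because
  f < (k + 1) h_i and f + g >= (n + 1) h_i. So the refined partition carries a
  sum below f and a sum below g whose coefficients add up to at least
  n h_i = (n / (n + 1)) l_i ([level_sum_grid_le]). Rounding thus loses only the
  factor n / (n + 1), which tends to 1. The loss must be multiplicative, with
  a step that depends on the block: an additive loss would be multiplied by
  mu(A_i), which may be infinite. *)

(** * Maps to finite types with measurable fibers *)

Section measurable_fibers.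
Context d (T : measurableType d) (R : realType).

Lemma measurable_truncn_preimage (h : T -> R) (Q : set nat) :
  measurable_fun setT h -> (forall x, (0 <= h x)%R) ->
  measurable [set x | Q (Num.truncn (h x))].
Proof.
move=> mh h_ge0.
have -> : [set x | Q (Num.truncn (h x))] =
    \bigcup_(n in Q) (h @^-1` `[n%:R, n.+1%:R[%classic).
  apply/seteqP; split=> x /=.
    by move=> Qx; exists (Num.truncn (h x)) => //=; rewrite in_itv/= truncn_itv.
  by move=> [n Qn] /=; rewrite in_itv/= -(truncn_eq _ (h_ge0 x)) => /eqP ->.
apply: bigcup_measurable => n _.
by rewrite -[X in measurable X]setTI; apply: mh => //; exact: measurable_itv.
Qed.

Definition measurable_fibers (I : finType) (c : T -> I) :=
  forall i, measurable (c @^-1` [set i]).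

Lemma measurable_fibers_pair (I J : finType) (a : T -> I) (b : T -> J) :
  measurable_fibers a -> measurable_fibers b ->
  measurable_fibers (fun x => (a x, b x)).
Proof.
move=> ma mb [i j].
have -> : (fun x => (a x, b x)) @^-1` [set (i, j)] =
    a @^-1` [set i] `&` b @^-1` [set j].
  by apply/seteqP; split=> x /= [-> ->].
exact: measurableI.
Qed.

(** The step of the grid may vary from one block of [a] to another, but on each
block it is constant, so the rounded ratio there is a rounding of one measurable
function. A zero step is harmless: division by it returns 0. *)
Lemma measurable_fibers_grid (I : finType) (a : T -> I) (u : T -> R)
    (h : I -> R) (m : nat) :
  measurable_fibers a -> measurable_fun setT u -> (forall x, (0 <= u x)%R) ->
  (forall i, (0 <= h i)%R) ->
  measurable_fibers
    (fun x => inord (minn m (Num.truncn (u x / h (a x)))) : 'I_m.+1).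
Proof.
move=> ma mu u_ge0 h_ge0 k.
have -> : (fun x => inord (minn m (Num.truncn (u x / h (a x)))) : 'I_m.+1)
      @^-1` [set k] =
    \bigcup_(i in [set: I]) (a @^-1` [set i] `&`
      [set x | (fun n => inord (minn m n) = k) (Num.truncn (u x / h i))]).
  apply/seteqP; split=> x /=; first by move=> xk; exists (a x).
  by move=> [i _ /= [->]].
apply: fin_bigcup_measurable => [|i _]; first exact: finite_finset.
apply: measurableI => //.
apply: (@measurable_truncn_preimage (fun x => u x / h i)%R
  [set n | inord (minn m n) = k]) => [|x]; last by rewrite divr_ge0.
by apply: measurable_funM => //; exact: measurable_cst.
Qed.

End measurable_fibers.

(** * Splitting a bound on a sum along a grid *)

(** Rounding [u] down to a multiple of the step loses less than one step, so out
of the [n.+1] steps covered by [u + v] at least [n] are covered by the two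
roundings together. The index is capped at [n.+1] to leave finitely many cases;
at [n.+1] the truncated difference asks nothing of [v]. *)
Lemma grid_split (R : realType) (n : nat) (h u v : R) :
  (0 <= h)%R -> (0 <= u)%R -> (0 <= v)%R -> (n.+1%:R * h <= u + v)%R ->
  let k := minn n.+1 (Num.truncn (u / h)) in
  (k%:R * h <= u)%R /\ ((n - k)%:R * h <= v)%R.
Proof.
rewrite le_eqVlt => /predU1P[<- u0 v0 _ k|h0 u0 v0 huv k]; first by rewrite !mulr0.
have uh0 : (0 <= u / h)%R by rewrite divr_ge0// ltW.
split.
  rewrite -ler_pdivlMr// -truncn_ge_nat//; exact: geq_minr.
have [nk|kn] := leqP n k; first by move: nk; rewrite -subn_eq0 => /eqP ->; rewrite mul0r.
have ktr : k = Num.truncn (u / h).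
  by move: kn; rewrite /k; lia.
have : (u < k.+1%:R * h)%R by rewrite -ltr_pdivrMr// ktr truncnS_gt.
rewrite natrB ?(ltnW kn)//; move: huv; rewrite -!natr1; lra.
Qed.

(** * Sums over partitions *)

Section level_sum.
Context d (T : measurableType d) (R : realType) (mu : set T -> \bar R).
Context (hmu : monotone_measure mu).

Definition level_sum (I : finType) (c : T -> I) (l : I -> R) : \bar R :=
  \sum_i (l i)%:E * mu (c @^-1` [set i]).

Lemma level_sum_ge0 (I : finType) (c : T -> I) (l : I -> R) :
  measurable_fibers c -> (forall i, (0 <= l i)%R) -> 0 <= level_sum c l.
Proof.
move=> mc l_ge0; apply: sume_ge0 => i _; rewrite mule_ge0 ?lee_fin//.
exact: (monotone_measure_ge0 hmu).
Qed.

Lemma le_level_sum (I : finType) (c : T -> I) (l m : I -> R) :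
  measurable_fibers c -> (forall i, (l i <= m i)%R) ->
  level_sum c l <= level_sum c m.
Proof.
move=> mc lm; apply: lee_sum => i _; apply: lee_wpmul2r; last by rewrite lee_fin.
exact: (monotone_measure_ge0 hmu).
Qed.

Lemma level_sumD (I : finType) (c : T -> I) (l m : I -> R) :
  (forall i, (0 <= l i)%R) -> (forall i, (0 <= m i)%R) ->
  level_sum c (fun i => l i + m i)%R = level_sum c l + level_sum c m.
Proof.
move=> l_ge0 m_ge0; rewrite /level_sum -big_split/=; apply: eq_bigr => i _.
by rewrite EFinD ge0_muleDl ?lee_fin.
Qed.

Lemma level_sumZ (I : finType) (c : T -> I) (l : I -> R) (r : R) :
  measurable_fibers c -> (forall i, (0 <= l i)%R) ->
  level_sum c (fun i => r * l i)%R = r%:E * level_sum c l.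
Proof.
move=> mc l_ge0; rewrite /level_sum ge0_sume_distrr => [|i _]; last first.
  by rewrite mule_ge0 ?lee_fin//; exact: (monotone_measure_ge0 hmu).
by apply: eq_bigr => i _; rewrite EFinM muleA.
Qed.

(** Allowing any finite type of indices, rather than an initial segment of the
naturals, lets refinements be indexed by products. *)
Lemma level_sum_le_pan (I : finType) (c : T -> I) (l : I -> R) (f : T -> R) :
  measurable_fibers c -> (forall i, (0 <= l i)%R) ->
  (forall x, (l (c x) <= f x)%R) -> level_sum c l <= pan_integral mu f.
Proof.
move=> mc l_ge0 lf; apply: ereal_sup_ubound.
exists #|I|, (fun k => c @^-1` [set enum_val k]), (fun k => l (enum_val k)).
split=> //.
- split=> //.
  + move=> j k _ _ [x [/= xj xk]]; apply: enum_val_inj; by rewrite -xj -xk.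
  + apply/seteqP; split=> // x _; exists (enum_rank (c x)) => //=.
    by rewrite enum_rankK.
- move=> x; rewrite -(big_enum_val (A := I)
    (fun i => l i * \1_(c @^-1` [set i]) x)%R)/=.
  rewrite (bigD1 (c x))//= big1 ?addr0 => [|i /negPf icx].
    by rewrite indicE mem_set ?mulr1.
  by rewrite indicE memNset ?mulr0//= => cxi; rewrite cxi eqxx in icx.
- by rewrite -(big_enum_val (A := I) (fun i => (l i)%:E * mu (c @^-1` [set i]))).
Qed.

(** Every partition in the supremum has a classifying map, obtained by choosing
for each point the block that contains it. *)
Lemma pan_integral_le (f : T -> R) (M : \bar R) :
  (forall (n : nat) (c : T -> 'I_n) (l : 'I_n -> R),
    measurable_fibers c -> (forall i, (0 <= l i)%R) ->
    (forall x, (l (c x) <= f x)%R) -> level_sum c l <= M) ->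
  pan_integral mu f <= M.
Proof.
move=> lsM; apply: ge_ereal_sup => _ [n [A [l [[mA tA cA] l_ge0 lf ->]]]].
have /choice[c cP] : forall x, exists i, A i x.
  by move=> x; have : (\bigcup_i A i) x by [rewrite cA]; move=> [i _ ?]; exists i.
have cE i : c @^-1` [set i] = A i.
  apply/seteqP; split=> x /=; first by move=> <-.
  by move=> Aix; apply: (tA (c x) i) => //; exists x.
have -> : \sum_(i < n) (l i)%:E * mu (A i) = level_sum c l.
  by apply: eq_bigr => i _; rewrite cE.
apply: lsM => // [i|x]; first by rewrite cE.
apply: le_trans (lf x); rewrite (bigD1 (c x))//= indicE mem_set// mulr1.
by rewrite lerDl; apply: sumr_ge0 => i _; rewrite mulr_ge0.
Qed.

Lemma pan_integral_ge0 (f : T -> R) : (forall x, (0 <= f x)%R) ->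
  0 <= pan_integral mu f.
Proof.
move=> f_ge0; have mc : measurable_fibers (fun _ : T => tt).
  by move=> i; rewrite preimage_cst; case: ifP.
apply: le_trans (level_sum_le_pan (l := fun=> 0%R) mc _ _) => //.
exact: level_sum_ge0.
Qed.

Context (hsub : subadditive_set_fun mu).

Lemma measure_preimage_le_sum (I : finType) (c : T -> I) (P : pred I) :
  measurable_fibers c ->
  mu (c @^-1` [set` P]) <= \sum_(i | P i) mu (c @^-1` [set i]).
Proof.
move=> mc.
have -> : c @^-1` [set` P] = \big[setU/set0]_(i | P i) (c @^-1` [set i]).
  rewrite -bigcup_seq_cond; apply/seteqP; split=> x /=.
    by move=> Pcx; exists (c x) => //=; rewrite mem_index_enum.
  by move=> [i /= /andP[_ Pi] ->].
pose K (B : set T) (s : \bar R) := measurable B /\ mu B <= s.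
suff [] : K (\big[setU/set0]_(i | P i) (c @^-1` [set i]))
    (\sum_(i | P i) mu (c @^-1` [set i])) by [].
elim/big_rec2: _ => [|i s B _ [mB leB]].
  by split; [exact: measurable0|rewrite (monotone_measure0 hmu)].
split; first exact: measurableU.
by apply: le_trans (hsub (mc i) mB) _; rewrite leeD2l.
Qed.

(** The blocks of [p \o c] are unions of blocks of [c] that carry the same
coefficient, hence finite subadditivity applies to each of them. *)
Lemma level_sum_coarsen (I J : finType) (p : I -> J) (c : T -> I) (l : J -> R) :
  measurable_fibers c -> (forall j, (0 <= l j)%R) ->
  level_sum (p \o c) l <= level_sum c (l \o p).
Proof.
move=> mc l_ge0; rewrite [leRHS]/level_sum (partition_big p xpredT)//=.
apply: lee_sum => j _.
rewrite (eq_bigr (fun i => (l j)%:E * mu (c @^-1` [set i]))); last first.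
  by move=> i /eqP ->.
rewrite -ge0_sume_distrr => [|i _]; last exact: (monotone_measure_ge0 hmu).
apply: lee_wpmul2l; first by rewrite lee_fin.
have -> : (p \o c) @^-1` [set j] = c @^-1` [set` (fun i => p i == j)].
  by apply/seteqP; split=> x /= /eqP.
exact: measure_preimage_le_sum.
Qed.

(** * The two inequalities *)

Section additivity.
Context (f g : T -> R).
Context (f_ge0 : forall x, (0 <= f x)%R) (g_ge0 : forall x, (0 <= g x)%R).

Lemma level_sumD_le_pan (I J : finType) (a : T -> I) (b : T -> J)
    (l : I -> R) (m : J -> R) :
  measurable_fibers a -> (forall i, (0 <= l i)%R) ->
  (forall x, (l (a x) <= f x)%R) ->
  measurable_fibers b -> (forall j, (0 <= m j)%R) ->
  (forall x, (m (b x) <= g x)%R) ->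
  level_sum a l + level_sum b m <= pan_integral mu (fun x => f x + g x)%R.
Proof.
move=> ma l_ge0 lf mb m_ge0 mg; pose c x := (a x, b x).
have mc : measurable_fibers c by exact: measurable_fibers_pair.
apply: (@le_trans _ _ (level_sum c (fun k => l k.1 + m k.2)%R)).
  rewrite level_sumD//; apply: leeD.
    exact: (level_sum_coarsen fst mc l_ge0).
  exact: (level_sum_coarsen snd mc m_ge0).
apply: level_sum_le_pan => // [k|x]; first exact: addr_ge0.
by rewrite lerD ?lf ?mg.
Qed.

(** The two suprema are taken one after the other, by moving the other summand to
the right-hand side; this is legitimate because everything is finite unless the
right-hand side is [+oo]. *)
Lemma pan_integralD_ge :
  pan_integral mu f + pan_integral mu g <= pan_integral mu (fun x => f x + g x)%R.
Proof.
set M := pan_integral mu (fun x => f x + g x)%R.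
have M_ge0 : 0 <= M by apply: pan_integral_ge0 => x; exact: addr_ge0.
have [->|Mfin] := eqVneq M +oo; first exact: leey.
have sub_fin s : 0 <= s -> s <= M -> s \is a fin_num.
  by move=> s_ge0 sM; rewrite ge0_fin_numE// (le_lt_trans sM)// ltey.
have gM : pan_integral mu g <= M.
  apply: pan_integral_le => n c l mc l_ge0 lg; apply: level_sum_le_pan => // x.
  by apply: le_trans (lg x) _; rewrite lerDr.
have gfin := sub_fin _ (pan_integral_ge0 g_ge0) gM.
rewrite -leeBrDr//; apply: pan_integral_le => n a l ma l_ge0 lf.
have afin : level_sum a l \is a fin_num.
  apply: sub_fin; first exact: level_sum_ge0.
  apply: level_sum_le_pan => // x.
  by apply: le_trans (lf x) _; rewrite lerDl.
rewrite leeBrDr// -leeBrDl//; apply: pan_integral_le => p b m mb m_ge0 mg.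
by rewrite leeBrDl//; exact: level_sumD_le_pan.
Qed.

(** Of the [n.+1] steps of length [l i / n.+1] that make up [l i], a number [k]
depending on the point is charged to [f], [n - k] are charged to [g],
and at most one is lost to rounding. *)
Lemma level_sum_grid_le (I : finType) (c : T -> I) (l : I -> R) (n : nat) :
  measurable_fun setT f ->
  measurable_fibers c -> (forall i, (0 <= l i)%R) ->
  (forall x, (l (c x) <= f x + g x)%R) ->
  (n%:R / n.+1%:R)%:E * level_sum c l <= pan_integral mu f + pan_integral mu g.
Proof.
move=> mf mc l_ge0 lfg; pose h i : R := (l i / n.+1%:R)%R.
have h_ge0 i : (0 <= h i)%R by rewrite divr_ge0.
pose k x : 'I_n.+2 := inord (minn n.+1 (Num.truncn (f x / h (c x)))).
pose e x := (c x, k x).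
have me : measurable_fibers e.
  by apply: measurable_fibers_pair => //; exact: measurable_fibers_grid.
pose lf (j : I * 'I_n.+2) := (j.2%:R * h j.1)%R.
pose lg (j : I * 'I_n.+2) := ((n - j.2)%:R * h j.1)%R.
have lf_ge0 j : (0 <= lf j)%R by rewrite mulr_ge0.
have lg_ge0 j : (0 <= lg j)%R by rewrite mulr_ge0.
have split_e x : (lf (e x) <= f x)%R /\ (lg (e x) <= g x)%R.
  rewrite /lf /lg /= inordK ?ltnS ?geq_minl//; apply: grid_split => //.
  by rewrite mulrC divfK.
apply: (@le_trans _ _ (level_sum e lf + level_sum e lg)); last first.
  by apply: leeD; apply: level_sum_le_pan => // x; have [] := split_e x.
rewrite -level_sumD// -level_sumZ//.
apply: le_trans (level_sum_coarsen fst me _) _ => [i|].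
  by rewrite mulr_ge0// divr_ge0.
apply: le_level_sum => // -[i j] /=.
rewrite /lf /lg /= -mulrDl -natrD mulrAC -mulrA (ler_wpM2r (h_ge0 i))//.
(* The sum [k + (n - k)] is [n], or [k] itself when [k] is the top index [n.+1]. *)
by rewrite ler_nat -maxnE leq_maxr.
Qed.

Lemma pan_integralD_le : measurable_fun setT f ->
  pan_integral mu (fun x => f x + g x)%R <= pan_integral mu f + pan_integral mu g.
Proof.
move=> mf; apply: pan_integral_le => m c l mc l_ge0 lfg.
apply/lee_mul01Pr => [|r /andP[r_gt0 r_lt1]]; first exact: level_sum_ge0.
(* The inequality [r <= n / n.+1] amounts to [r / (1 - r) <= n]. *)
pose n := (Num.truncn (r / (1 - r))).+1.
have rn : (r <= n%:R / n.+1%:R)%R.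
  have : (r / (1 - r) < n%:R)%R by exact: truncnS_gt.
  rewrite ltr_pdivrMr ?subr_gt0// ler_pdivlMr// -natr1; lra.
apply: le_trans (level_sum_grid_le n mf mc l_ge0 lfg).
by apply: lee_wpmul2r; [exact: level_sum_ge0|rewrite lee_fin].
Qed.

End additivity.
End level_sum.

Theorem theorem3p1 (d : measure_display) (T : measurableType d)
    (R : realType) (mu : set T -> \bar R) (hmu : monotone_measure mu)
    (hsub : subadditive_set_fun mu) (f g : T -> R)
    (mf : measurable_fun setT f) (f_ge0 : forall x, (0 <= f x)%R)
    (mg : measurable_fun setT g) (g_ge0 : forall x, (0 <= g x)%R) :
  pan_integral mu (fun x => f x + g x)%R
  = pan_integral mu f + pan_integral mu g.
Proof.
by apply/eqP; rewrite eq_le pan_integralD_le// pan_integralD_ge.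
Qed.
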